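(* Let $g\in\mathcal{G}_0^\infty$ be differentiable on $(0,1)$ and satisfy $\limsup_{x\to0^+}x g'(x)/g(x)<1$. Then for every $\gamma\ge0$ there exists a process $(X,\Sigma,\mu,T,\mathcal{P})$ such that $h(g,\mathcal{P})=\gamma$. Here $T$ is a measure-preserving automorphism of a probability space $(X,\Sigma,\mu)$ and $\mathcal{P}$ is a finite measurable partition.
   Context: $\mathcal{G}_0$ is the set of concave functions $g:[0,1]\to\mathbb{R}$ with $g(0)=\lim_{x\to0^+}g(x)=0$. Let $\eta(x)=-x\log x$ and $\eta(0)=0$. Define $\mathcal{G}_0^\infty=\{g\in\mathcal{G}_0:\lim_{x\to0^+}g(x)/\eta(x)=\infty\}$. For a finite measurable partition $\mathcal{P}$, let $\mathcal{P}_n=\bigvee_{i=0}^{n-1}T^{-i}\mathcal{P}$, $H(g,\mathcal{P})=\sum_{A\in\mathcal{P}}g(\mu(A))$, and $h(g,\mathcal{P})=\limsup_{n\to\infty}\frac1nH(g,\mathcal{P}_n)$. *)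

(* Defs.v *)
From Stdlib Require Import Reals Lra List.
Open Scope R_scope.

Definition preimage {X : Type} (T : X -> X) (A : X -> Prop) : X -> Prop :=
  fun x => A (T x).

Definition sigma_algebra {X : Type} (S : (X -> Prop) -> Prop) : Prop :=
  S (fun _ => True) /\
  (forall A, S A -> S (fun x => ~ A x)) /\
  (forall F : nat -> X -> Prop, (forall n, S (F n)) -> S (fun x => exists n, F n x)).

Definition prob_measure {X : Type} (S : (X -> Prop) -> Prop) (mu : (X -> Prop) -> R) : Prop :=
  (forall A, S A -> 0 <= mu A) /\
  mu (fun _ => True) = 1 /\
  (forall F : nat -> X -> Prop,
     (forall n, S (F n)) ->
     (forall n m x, n <> m -> F n x -> F m x -> False) ->
     infinite_sum (fun n => mu (F n)) (mu (fun x => exists n, F n x))).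

Definition prob_space {X : Type} (S : (X -> Prop) -> Prop) (mu : (X -> Prop) -> R) : Prop :=
  sigma_algebra S /\ prob_measure S mu.

Definition mp_automorphism {X : Type} (S : (X -> Prop) -> Prop) (mu : (X -> Prop) -> R)
  (T : X -> X) : Prop :=
  exists Tinv : X -> X,
    (forall x, Tinv (T x) = x) /\ (forall x, T (Tinv x) = x) /\
    (forall A, S A -> S (preimage T A)) /\
    (forall A, S A -> S (preimage Tinv A)) /\
    (forall A, S A -> mu (preimage T A) = mu A).

(* a finite measurable partition given by k cells P 0, ..., P (k-1)
   (empty cells allowed; they contribute g 0 = 0) *)
Definition finite_meas_partition {X : Type} (S : (X -> Prop) -> Prop)
  (k : nat) (P : nat -> X -> Prop) : Prop :=
  (forall i, (i < k)%nat -> S (P i)) /\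
  (forall i j x, (i < k)%nat -> (j < k)%nat -> i <> j -> P i x -> P j x -> False) /\
  (forall x, exists i, (i < k)%nat /\ P i x).

Fixpoint words (k n : nat) : list (list nat) :=
  match n with
  | O => nil :: nil
  | S n' => flat_map (fun w => map (fun a => w ++ a :: nil) (seq 0 k)) (words k n')
  end.

Definition join_cell {X : Type} (T : X -> X) (P : nat -> X -> Prop) (w : list nat) : X -> Prop :=
  fun x => forall i, (i < length w)%nat -> P (nth i w O) (Nat.iter i T x).

Definition H_join {X : Type} (mu : (X -> Prop) -> R) (T : X -> X)
  (k : nat) (P : nat -> X -> Prop) (g : R -> R) (n : nat) : R :=
  fold_right Rplus 0 (map (fun w => g (mu (join_cell T P w))) (words k n)).

Definition is_limsup (u : nat -> R) (l : R) : Prop :=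
  forall eps, 0 < eps ->
    (exists N, forall n, (N <= n)%nat -> u n < l + eps) /\
    (forall N, exists n, (N <= n)%nat /\ l - eps < u n).

Definition h_entropy_is {X : Type} (mu : (X -> Prop) -> R) (T : X -> X)
  (k : nat) (P : nat -> X -> Prop) (g : R -> R) (gamma : R) : Prop :=
  is_limsup (fun n => H_join mu T k P g n / INR n) gamma.

Definition eta (x : R) : R := if Req_EM_T x 0 then 0 else - x * ln x.

Definition in_G0 (g : R -> R) : Prop :=
  (forall x y t, 0 <= x <= 1 -> 0 <= y <= 1 -> 0 <= t <= 1 ->
     t * g x + (1 - t) * g y <= g (t * x + (1 - t) * y)) /\
  g 0 = 0 /\
  (forall eps, 0 < eps -> exists delta, 0 < delta /\
     forall x, 0 < x < delta -> Rabs (g x) < eps).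

Definition in_G0_infty (g : R -> R) : Prop :=
  in_G0 g /\
  (forall M, exists delta, 0 < delta /\
     forall x, 0 < x < delta -> M < g x / eta x).

(* Main.v *)
Require Import Defs.
From Stdlib Require Import Reals Ranalysis5 Lra Lia List Arith Classical ClassicalEpsilon Wf_nat.
From Coquelicot Require Import Coquelicot.
Open Scope R_scope.

(** No ergodicity is asked for, so the system can be a countable union of finite ones: component
    [j] carries mass [v j] spread uniformly over the binary words of length [L j], on which the
    automorphism is cyclic rotation. Words of length [n <= L j] then all have mass
    [v j / 2 ^ n] in component [j], while for [n >= L j] its [2 ^ L j] atoms are separated, so it
    contributes at most [2 ^ m * g (v j / 2 ^ m)] with [m = min n (L j)]. This is at most [1] for
    [m] below any prescribed bound once [v j] is small, but as [g / eta] tends to infinity it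
    exceeds [gamma * m] for some larger [m]; taking the first such [m] as [L j] and then lowering
    [v j] until equality holds there (intermediate value theorem) makes the contribution at most
    [gamma * n + 1] for all [n], and equal to [gamma * n] at [n = L j]. If the
    lengths grow and the masses decay fast enough, only one component matters at each time scale,
    and the limsup is exactly [gamma]. Component [0], with [L 0 = 0], is a fixed point carrying the
    remaining mass. *)

(** * Indicators and finite sums over words *)

Definition ind (P : Prop) : R := if excluded_middle_informative P then 1 else 0.

Lemma ind_true (P : Prop) : P -> ind P = 1.
Proof. unfold ind; destruct (excluded_middle_informative P); tauto. Qed.

Lemma ind_false (P : Prop) : ~ P -> ind P = 0.
Proof. unfold ind; destruct (excluded_middle_informative P); tauto. Qed.

Lemma ind_iff (P Q : Prop) : (P <-> Q) -> ind P = ind Q.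
Proof.
  intros H; unfold ind.
  destruct (excluded_middle_informative P), (excluded_middle_informative Q); tauto.
Qed.

Lemma ind_bound (P : Prop) : 0 <= ind P <= 1.
Proof. unfold ind; destruct (excluded_middle_informative P); lra. Qed.

(** Convertible with the sum in [H_join], so that the lemmas on [lsum] apply there directly. *)
Definition lsum {A : Type} (F : A -> R) (l : list A) : R := fold_right Rplus 0 (map F l).

Lemma lsum_le {A : Type} (F G : A -> R) (l : list A) :
  (forall a, In a l -> F a <= G a) -> lsum F l <= lsum G l.
Proof.
  unfold lsum; induction l as [|a l IH]; simpl; intros H; [lra|].
  apply Rplus_le_compat; auto.
Qed.

Lemma lsum_ext {A : Type} (F G : A -> R) (l : list A) :
  (forall a, In a l -> F a = G a) -> lsum F l = lsum G l.
Proof. intros H; apply Rle_antisym; apply lsum_le; intros a Ha; rewrite H; auto with real. Qed.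

Lemma lsum_plus {A : Type} (F G : A -> R) (l : list A) :
  lsum (fun a => F a + G a) l = lsum F l + lsum G l.
Proof. unfold lsum; induction l as [|a l IH]; simpl; [|rewrite IH]; ring. Qed.

Lemma lsum_scal {A : Type} (c : R) (F : A -> R) (l : list A) :
  lsum (fun a => c * F a) l = c * lsum F l.
Proof. unfold lsum; induction l as [|a l IH]; simpl; [|rewrite IH]; ring. Qed.

Lemma lsum_words_S (F : list nat -> R) (n : nat) :
  lsum F (words 2 (S n)) =
  lsum (fun w => F (w ++ 0%nat :: nil) + F (w ++ 1%nat :: nil)) (words 2 n).
Proof.
  unfold lsum; simpl; induction (words 2 n) as [|w l IH]; [reflexivity|].
  simpl; rewrite IH; ring.
Qed.

Lemma lsum_words_const (c : R) (n : nat) : lsum (fun _ => c) (words 2 n) = 2 ^ n * c.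
Proof.
  revert c; induction n as [|n IH]; intros c; [unfold lsum; simpl; ring|].
  rewrite lsum_words_S, IH; simpl; ring.
Qed.

Lemma words_spec (n : nat) (w : list nat) :
  In w (words 2 n) -> length w = n /\ List.Forall (fun a => (a < 2)%nat) w.
Proof.
  revert w; induction n as [|n IH]; simpl; intros w H.
  - destruct H as [<-|[]]; auto.
  - apply in_flat_map in H; destruct H as (u & Hu & Hw).
    destruct (IH u Hu) as [Hl Hf].
    assert (exists a, (a < 2)%nat /\ w = u ++ a :: nil) as (a & Ha & ->).
    { destruct Hw as [<-|[<-|[]]]; eauto. }
    rewrite length_app, Hl; simpl; split; [lia|].
    apply Forall_app; auto.
Qed.

(** * Uniform measure on binary words *)

(** Expectation under the uniform law on words of length [n]; recursion on the first letter replaces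
    an enumeration of the [2 ^ n] words. *)
Fixpoint mean (n : nat) (f : list bool -> R) : R :=
  match n with
  | O => f nil
  | S n => (mean n (fun x => f (true :: x)) + mean n (fun x => f (false :: x))) / 2
  end.

Lemma mean_le (n : nat) (f h : list bool -> R) :
  (forall x, length x = n -> f x <= h x) -> mean n f <= mean n h.
Proof.
  revert f h; induction n as [|n IH]; simpl; intros f h H; [auto|].
  assert (A := fun b => IH (fun x => f (b :: x)) (fun x => h (b :: x))).
  assert (B := A true); assert (C := A false); simpl in B, C.
  enough (mean n (fun x => f (true :: x)) <= mean n (fun x => h (true :: x)) /\
          mean n (fun x => f (false :: x)) <= mean n (fun x => h (false :: x))) by lra.
  split; [apply B|apply C]; intros x Hx; apply H; simpl; lia.
Qed.

Lemma mean_ext (n : nat) (f h : list bool -> R) :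
  (forall x, length x = n -> f x = h x) -> mean n f = mean n h.
Proof. intros H; apply Rle_antisym; apply mean_le; intros x Hx; rewrite H; auto with real. Qed.

Lemma mean_const (n : nat) (c : R) : mean n (fun _ => c) = c.
Proof. induction n as [|n IH]; simpl; [|rewrite IH]; lra. Qed.

Lemma mean_plus (n : nat) (f h : list bool -> R) :
  mean n (fun x => f x + h x) = mean n f + mean n h.
Proof.
  revert f h; induction n as [|n IH]; simpl; intros f h; [ring|].
  rewrite (IH (fun x => f (true :: x))), (IH (fun x => f (false :: x))); field.
Qed.

Lemma mean_ind_bound (n : nat) (A : list bool -> Prop) : 0 <= mean n (fun x => ind (A x)) <= 1.
Proof.
  split; [rewrite <- (mean_const n 0)|rewrite <- (mean_const n 1)];
    apply mean_le; intros x _; apply ind_bound.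
Qed.

Lemma mean_lsum {A : Type} (n : nat) (F : A -> list bool -> R) (l : list A) :
  lsum (fun a => mean n (F a)) l = mean n (fun x => lsum (fun a => F a x) l).
Proof.
  unfold lsum; induction l as [|a l IH]; simpl; [now rewrite mean_const|].
  now rewrite IH, <- mean_plus.
Qed.

Lemma mean_point (n : nat) (f : list bool -> R) (y : list bool) :
  length y = n -> (forall x, length x = n -> x <> y -> f x = 0) -> mean n f = f y / 2 ^ n.
Proof.
  revert f y; induction n as [|n IH]; intros f y Hy H.
  - destruct y; [simpl; field|discriminate].
  - destruct y as [|b y]; [discriminate|]; injection Hy as Hy.
    assert (Hb : mean n (fun x => f (b :: x)) = f (b :: y) / 2 ^ n).
    { apply (IH (fun x => f (b :: x)) y Hy); intros x Hx Hne; apply H; simpl; congruence. }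
    assert (Hn : mean n (fun x => f (negb b :: x)) = 0).
    { rewrite <- (mean_const n 0); apply mean_ext; intros x Hx; apply H; simpl; [congruence|].
      destruct b; discriminate. }
    assert (Hp := pow_lt 2 n ltac:(lra)).
    simpl; destruct b; simpl in Hn; rewrite Hb, Hn; field; lra.
Qed.

(** The definition splits by the first letter. That splitting by the last letter gives the same
    value is what invariance under rotation amounts to. *)
Lemma mean_snoc (n : nat) (f : list bool -> R) :
  mean (S n) f = (mean n (fun x => f (x ++ true :: nil)) + mean n (fun x => f (x ++ false :: nil))) / 2.
Proof.
  revert f; induction n as [|n IH]; intros f; [reflexivity|].
  change (mean (S (S n)) f) with
    ((mean (S n) (fun x => f (true :: x)) + mean (S n) (fun x => f (false :: x))) / 2).
  rewrite (IH (fun x => f (true :: x))), (IH (fun x => f (false :: x))); simpl; field.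
Qed.

Lemma mean_lim (n : nat) (f : nat -> list bool -> R) (h : list bool -> R) :
  (forall x, is_lim_seq (fun k => f k x) (h x)) -> is_lim_seq (fun k => mean n (f k)) (mean n h).
Proof.
  revert f h; induction n as [|n IH]; intros f h H; [apply H|]; simpl.
  unfold Rdiv; apply (is_lim_seq_scal_r _ (/ 2) (Finite _)), is_lim_seq_plus';
    apply (IH (fun k x => f k (_ :: x))); intros x; apply H.
Qed.

(** * Cyclic rotation and the words read along its orbits *)

Definition rot (x : list bool) : list bool :=
  match x with nil => nil | a :: y => y ++ a :: nil end.

Definition unrot (x : list bool) : list bool :=
  match rev x with nil => nil | a :: y => a :: rev y end.

Lemma unrot_rot (x : list bool) : unrot (rot x) = x.
Proof.
  destruct x as [|a x]; [reflexivity|].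
  unfold unrot; simpl; rewrite rev_app_distr; simpl; now rewrite rev_involutive.
Qed.

Lemma rot_unrot (x : list bool) : rot (unrot x) = x.
Proof.
  unfold unrot; destruct (rev x) as [|a y] eqn:E; apply (f_equal (@rev bool)) in E;
    rewrite rev_involutive in E; now subst.
Qed.

Lemma mean_rot (n : nat) (f : list bool -> R) : mean n (fun x => f (rot x)) = mean n f.
Proof. destruct n as [|n]; [reflexivity|]; now rewrite (mean_snoc n f). Qed.

Lemma iter_rot (i : nat) (x : list bool) :
  (i <= length x)%nat -> Nat.iter i rot x = skipn i x ++ firstn i x.
Proof.
  induction i as [|i IH]; intros H; simpl Nat.iter.
  - now rewrite app_nil_r.
  - rewrite IH by lia.
    (* Only the right-hand side is cut at position [i]; the letter about to be moved is the head of
       [skipn i x]. *)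
    rewrite <- (firstn_skipn i x) at 3 4.
    assert (Hl : length (firstn i x) = i) by (rewrite length_firstn; lia).
    destruct (skipn i x) as [|a y] eqn:E.
    { apply (f_equal (@length bool)) in E; rewrite length_skipn in E; simpl in E; lia. }
    rewrite skipn_app, firstn_app, Hl.
    replace (S i - i)%nat with 1%nat by lia.
    rewrite (skipn_all2 (firstn i x)), (firstn_all2 (firstn i x)) by lia; simpl.
    now rewrite <- app_assoc.
Qed.

Lemma hd_iter_rot (i : nat) (x : list bool) :
  (i < length x)%nat -> hd false (Nat.iter i rot x) = nth i x false.
Proof.
  intros H; rewrite iter_rot by lia.
  rewrite <- (firstn_skipn i x) at 3.
  rewrite app_nth2; rewrite length_firstn; [|lia].
  replace (i - Nat.min i (length x))%nat with O by lia.
  destruct (skipn i x) as [|a y] eqn:E; [|reflexivity].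
  apply (f_equal (@length bool)) in E; rewrite length_skipn in E; simpl in E; lia.
Qed.

(** The trace of a join cell on one component. When [w] is longer than [x], the reading wraps
    around. *)
Definition reads (w : list nat) (x : list bool) : Prop :=
  forall i, (i < length w)%nat -> nth i w O = Nat.b2n (hd false (Nat.iter i rot x)).

(** Each prescribed letter, being [0] or [1], selects exactly one of the two halves in the recursion
    of [mean]. *)
Lemma mean_prefix (w : list nat) (n : nat) :
  List.Forall (fun a => (a < 2)%nat) w -> (length w <= n)%nat ->
  mean n (fun x => ind (forall i, (i < length w)%nat -> nth i w O = Nat.b2n (nth i x false)))
  = / 2 ^ length w.
Proof.
  revert n; induction w as [|a w IH]; intros n Hw Hn.
  - rewrite <- (mean_const n (/ 2 ^ length nil)); apply mean_ext; intros x _.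
    rewrite ind_true; [simpl; field|simpl; intros; lia].
  - destruct n as [|n]; [simpl in Hn; lia|].
    inversion Hw as [|? ? Ha Hw']; subst; simpl in Hn.
    assert (Hd : forall b : bool, mean n (fun x => ind (forall i, (i < length (a :: w))%nat ->
        nth i (a :: w) O = Nat.b2n (nth i (b :: x) false))) =
        if Nat.eqb a (Nat.b2n b) then / 2 ^ length w else 0).
    { intros b; destruct (Nat.eqb_spec a (Nat.b2n b)) as [E|E].
      - rewrite <- (IH n Hw' ltac:(lia)); apply mean_ext; intros x _; apply ind_iff; split.
        + intros H i Hi; apply (H (S i)); simpl; lia.
        + intros H [|i] Hi; [exact E|apply H; simpl in Hi; lia].
      - rewrite <- (mean_const n 0); apply mean_ext; intros x _; apply ind_false.
        intros H; apply E, (H O); simpl; lia. }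
    cbn [mean]; rewrite (Hd true), (Hd false).
    assert (Hp := pow_lt 2 (length w) ltac:(lra)).
    destruct a as [|[|a]]; [| |lia]; simpl; field; lra.
Qed.

Lemma mean_reads_long (w : list nat) (n : nat) :
  List.Forall (fun a => (a < 2)%nat) w -> (length w <= n)%nat ->
  mean n (fun x => ind (reads w x)) = / 2 ^ length w.
Proof.
  intros Hw Hn; rewrite <- (mean_prefix w n Hw Hn); apply mean_ext; intros x Hx; apply ind_iff.
  unfold reads; split; intros H i Hi; rewrite (H i Hi), hd_iter_rot; auto; lia.
Qed.

(** The first [n] letters read determine a point of length [n], so at most one atom of mass
    [/ 2 ^ n] reads [w]: the word [y] obtained by decoding these letters. *)
Lemma mean_reads_short (w : list nat) (n : nat) :
  (n <= length w)%nat ->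
  mean n (fun x => ind (reads w x)) = 0 \/ mean n (fun x => ind (reads w x)) = / 2 ^ n.
Proof.
  intros Hn; set (y := map (fun a => Nat.eqb a 1) (firstn n w)).
  assert (Hy : length y = n) by (unfold y; rewrite length_map, length_firstn; lia).
  rewrite (mean_point n _ y Hy).
  - unfold ind; destruct (excluded_middle_informative (reads w y)); [right|left];
      unfold Rdiv; ring.
  - intros x Hx Hne; apply ind_false; intros H; apply Hne.
    apply (nth_ext _ _ false false); [congruence|]; intros i Hi.
    assert (E := H i ltac:(lia)); rewrite hd_iter_rot in E by lia.
    unfold y; change false with ((fun a => Nat.eqb a 1) O) at 2.
    rewrite map_nth, nth_firstn.
    destruct (Nat.ltb_spec i n); [|lia].
    rewrite E; destruct (nth i x false); reflexivity.
Qed.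

Lemma reads_snoc (w : list nat) (a : nat) (x : list bool) :
  reads (w ++ a :: nil) x <->
  reads w x /\ a = Nat.b2n (hd false (Nat.iter (length w) rot x)).
Proof.
  unfold reads; rewrite length_app; simpl; split.
  - intros H; split.
    + intros i Hi; rewrite <- (H i) by lia; now rewrite app_nth1.
    + rewrite <- (H (length w)) by lia; now rewrite nth_middle.
  - intros [H Ha] i Hi.
    destruct (Nat.eq_dec i (length w)) as [->|]; [now rewrite nth_middle|].
    rewrite app_nth1 by lia; apply H; lia.
Qed.

(** Every point has exactly one itinerary of each length, since exactly one of the two letters
    extends it. *)
Lemma lsum_ind_reads (n : nat) (x : list bool) : lsum (fun w => ind (reads w x)) (words 2 n) = 1.
Proof.
  induction n as [|n IH].
  - unfold lsum; simpl; rewrite ind_true; [ring|intros i Hi; simpl in Hi; lia].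
  - rewrite lsum_words_S, <- IH; apply lsum_ext; intros w _.
    rewrite (ind_iff _ _ (reads_snoc w 0 x)), (ind_iff _ _ (reads_snoc w 1 x)).
    unfold ind; destruct (hd false (Nat.iter (length w) rot x)); simpl;
      repeat destruct excluded_middle_informative; try lra; exfalso; intuition; discriminate.
Qed.

Lemma lsum_mean_reads (m n : nat) :
  lsum (fun w => mean m (fun x => ind (reads w x))) (words 2 n) = 1.
Proof.
  rewrite (mean_lsum m (fun w x => ind (reads w x))), <- (mean_const m 1).
  apply mean_ext; intros x _; apply lsum_ind_reads.
Qed.

(** * Mixtures of uniform measures *)

Lemma ex_series_weighted (v e : nat -> R) :
  (forall j, 0 <= v j) -> ex_series v -> (forall j, 0 <= e j <= 1) ->
  ex_series (fun j => v j * e j).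
Proof.
  intros Hv Hs He; apply (@ex_series_le R_AbsRing R_CompleteNormedModule _ v); [|exact Hs]; intros j.
  change (Rabs (v j * e j) <= v j); specialize (Hv j); specialize (He j).
  rewrite Rabs_pos_eq by (apply Rmult_le_pos; lra).
  rewrite <- (Rmult_1_r (v j)) at 2; apply Rmult_le_compat_l; lra.
Qed.

Lemma Series_split (u : nat -> R) (n : nat) :
  ex_series u -> Series u = sum_f_R0 u n + Series (fun k => u (S n + k)%nat).
Proof. intros H; rewrite (Series_incr_n u (S n)) by (lia || exact H); reflexivity. Qed.

Lemma Series_nonneg (u : nat -> R) : (forall k, 0 <= u k) -> ex_series u -> 0 <= Series u.
Proof.
  intros Hu Hs; replace 0 with (Series (fun k : nat => 0 * u k)) by (rewrite Series_scal_l; ring).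
  apply Series_le; [|exact Hs]; intros k; specialize (Hu k); lra.
Qed.

Lemma Series_tail_lim (v : nat -> R) (eps : R) :
  ex_series v -> 0 < eps -> exists N, Series (fun k => v (S N + k)%nat) < eps.
Proof.
  intros Hs Heps.
  assert (H := Series_correct v Hs); apply is_series_Reals in H.
  destruct (H eps Heps) as [N HN]; specialize (HN N (le_n N)).
  exists N; unfold Rdist in HN; rewrite (Series_split v N Hs) in HN.
  apply Rabs_def2 in HN; lra.
Qed.

(** Dominated convergence: beyond some [N] the weights alone sum to less than [eps / 2], and the
    finitely many earlier terms tend to zero. *)
Lemma Series_dominated_lim (v : nat -> R) (e : nat -> nat -> R) :
  (forall j, 0 <= v j) -> ex_series v -> (forall j n, 0 <= e j n <= 1) ->
  (forall j, is_lim_seq (e j) 0) -> is_lim_seq (fun n => Series (fun j => v j * e j n)) 0.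
Proof.
  intros Hv Hs He Hl; apply is_lim_seq_Reals; intros eps Heps.
  destruct (Series_tail_lim v (eps / 2) Hs ltac:(lra)) as [N HN].
  assert (Hf : is_lim_seq (fun n => sum_f_R0 (fun j => v j * e j n) N) 0).
  { clear HN; induction N as [|N IH]; simpl.
    - rewrite <- (Rmult_0_r (v O)); apply (is_lim_seq_scal_l (e O) (v O) (Finite 0)), Hl.
    - rewrite <- (Rplus_0_r 0); apply is_lim_seq_plus'; [exact IH|].
      rewrite <- (Rmult_0_r (v (S N))).
      apply (is_lim_seq_scal_l (e (S N)) (v (S N)) (Finite 0)), Hl. }
  apply is_lim_seq_Reals in Hf; destruct (Hf (eps / 2) ltac:(lra)) as [M HM].
  exists M; intros n Hn; specialize (HM n Hn); unfold Rdist in *.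
  assert (Hw : ex_series (fun j => v j * e j n)) by (apply ex_series_weighted; auto).
  assert (Hp : 0 <= Series (fun j => v j * e j n)).
  { apply Series_nonneg; [|exact Hw]; intros j; apply Rmult_le_pos; [apply Hv|apply He]. }
  rewrite Rminus_0_r, Rabs_pos_eq by exact Hp.
  rewrite (Series_split _ N Hw).
  assert (Ht : Series (fun k => v (S N + k)%nat * e (S N + k)%nat n) <=
               Series (fun k => v (S N + k)%nat)).
  { apply Series_le; [|apply (ex_series_incr_n v), Hs]; intros k.
    specialize (Hv (S N + k)%nat); specialize (He (S N + k)%nat n); split.
    - apply Rmult_le_pos; lra.
    - rewrite <- (Rmult_1_r (v (S N + k)%nat)) at 2; apply Rmult_le_compat_l; lra. }
  apply Rabs_def2 in HM; lra.
Qed.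

(** Component [j] has mass [v j]; pairs [(j, x)] with [length x <> L j] form a null set. Every
    subset gets a value, so the sigma-algebra can be the full power set. *)
Definition mix (L : nat -> nat) (v : nat -> R) (A : nat * list bool -> Prop) : R :=
  Series (fun j => v j * mean (L j) (fun x => ind (A (j, x)))).

Lemma ex_series_mix (L : nat -> nat) (v : nat -> R) (A : nat * list bool -> Prop) :
  (forall j, 0 <= v j) -> ex_series v ->
  ex_series (fun j => v j * mean (L j) (fun x => ind (A (j, x)))).
Proof.
  intros Hv Hs; apply ex_series_weighted; auto; intros j.
  apply (mean_ind_bound (L j) (fun x => A (j, x))).
Qed.

Lemma mix_nonneg (L : nat -> nat) (v : nat -> R) (A : nat * list bool -> Prop) :
  (forall j, 0 <= v j) -> ex_series v -> 0 <= mix L v A.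
Proof.
  intros Hv Hs; apply Series_nonneg; [|apply ex_series_mix; auto]; intros j.
  apply Rmult_le_pos; [apply Hv|apply (mean_ind_bound (L j) (fun x => A (j, x)))].
Qed.

Lemma mix_iff (L : nat -> nat) (v : nat -> R) (A B : nat * list bool -> Prop) :
  (forall p, A p <-> B p) -> mix L v A = mix L v B.
Proof.
  intros H; apply Series_ext; intros j; f_equal; apply mean_ext; intros x _; apply ind_iff, H.
Qed.

Lemma mix_add (L : nat -> nat) (v : nat -> R) (A B : nat * list bool -> Prop) :
  (forall j, 0 <= v j) -> ex_series v -> (forall p, A p -> B p -> False) ->
  mix L v (fun p => A p \/ B p) = mix L v A + mix L v B.
Proof.
  intros Hv Hs Hd; unfold mix; rewrite <- Series_plus by (apply ex_series_mix; auto).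
  apply Series_ext; intros j; rewrite <- Rmult_plus_distr_l, <- mean_plus; f_equal.
  apply mean_ext; intros x _; specialize (Hd (j, x)); unfold ind.
  repeat destruct excluded_middle_informative; try lra; tauto.
Qed.

Lemma mix_full (L : nat -> nat) (v : nat -> R) : is_series v 1 -> mix L v (fun _ => True) = 1.
Proof.
  intros Hs; rewrite <- (is_series_unique v 1 Hs); apply Series_ext; intros j.
  rewrite (mean_ext _ _ (fun _ => 1)), mean_const; [ring|].
  intros; now apply ind_true.
Qed.

(** The remainders of the series are the masses of the sets [tail n]. These decrease to the empty
    set, because a point lies in at most one [F i], so dominated convergence applies. *)
Lemma mix_sigma_additive (L : nat -> nat) (v : nat -> R) (F : nat -> nat * list bool -> Prop) :
  (forall j, 0 <= v j) -> ex_series v ->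
  (forall n m p, n <> m -> F n p -> F m p -> False) ->
  infinite_sum (fun n => mix L v (F n)) (mix L v (fun p => exists n, F n p)).
Proof.
  intros Hv Hs Hd.
  set (tail := fun (n : nat) p => exists i, (n <= i)%nat /\ F i p).
  assert (Hstep : forall n, mix L v (tail n) = mix L v (F n) + mix L v (tail (S n))).
  { intros n; rewrite <- mix_add; auto.
    - apply mix_iff; intros p; unfold tail; split.
      + intros (i & Hi & H); destruct (Nat.eq_dec n i) as [->|]; [now left|].
        right; exists i; split; [lia|exact H].
      + intros [H|(i & Hi & H)]; [exists n|exists i]; split; auto; lia.
    - intros p H (i & Hi & H'); apply (Hd n i p); auto; lia. }
  assert (Hsplit : forall n, mix L v (fun p => exists i, F i p) =
            sum_f_R0 (fun i => mix L v (F i)) n + mix L v (tail (S n))).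
  { induction n as [|n IH].
    - simpl; rewrite <- Hstep; apply mix_iff; intros p; unfold tail; split.
      + intros (i & H); exists i; split; [lia|exact H].
      + intros (i & _ & H); now exists i.
    - rewrite IH, (Hstep (S n)); simpl; ring. }
  assert (Hlim : is_lim_seq (fun n => mix L v (tail n)) 0).
  { apply Series_dominated_lim; auto.
    - intros j n; apply (mean_ind_bound (L j) (fun x => tail n (j, x))).
    - intros j; rewrite <- (mean_const (L j) 0).
      apply (mean_lim (L j) (fun n x => ind (tail n (j, x))) (fun _ => 0)); intros x.
      destruct (excluded_middle_informative (exists i, F i (j, x))) as [[i Hi]|Hno].
      + apply is_lim_seq_ext_loc with (fun _ => 0); [|apply is_lim_seq_const].
        exists (S i); intros n Hn; symmetry; apply ind_false; intros (k & Hk & H).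
        apply (Hd i k (j, x)); auto; lia.
      + apply is_lim_seq_ext with (fun _ => 0); [|apply is_lim_seq_const].
        intros n; symmetry; apply ind_false; intros (k & _ & H); apply Hno; now exists k. }
  apply is_lim_seq_Reals in Hlim; intros eps Heps.
  destruct (Hlim eps Heps) as [N HN]; exists N; intros n Hn.
  specialize (HN (S n) ltac:(lia)); unfold Rdist in *; rewrite (Hsplit n).
  rewrite <- Rabs_Ropp; replace (- _) with (mix L v (tail (S n)) - 0) by ring; exact HN.
Qed.

(** * The automorphism, its partition and the masses of words *)

Definition shift (p : nat * list bool) : nat * list bool := (fst p, rot (snd p)).

(** The default [false] puts the empty word, the point of a component of length [0], into cell
    [0]. *)
Definition first_letter (i : nat) (p : nat * list bool) : Prop := i = Nat.b2n (hd false (snd p)).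

Lemma mix_prob_space (L : nat -> nat) (v : nat -> R) :
  (forall j, 0 <= v j) -> is_series v 1 -> prob_space (fun _ => True) (mix L v).
Proof.
  intros Hv Hs; assert (He : ex_series v) by now exists 1.
  split; [repeat split|split; [|split]].
  - intros A _; now apply mix_nonneg.
  - now apply mix_full.
  - intros F _ Hd; now apply mix_sigma_additive.
Qed.

Lemma shift_automorphism (L : nat -> nat) (v : nat -> R) :
  mp_automorphism (fun _ => True) (mix L v) shift.
Proof.
  exists (fun p => (fst p, unrot (snd p))); repeat split.
  - intros [j x]; unfold shift; simpl; now rewrite unrot_rot.
  - intros [j x]; unfold shift; simpl; now rewrite rot_unrot.
  - intros A _; apply Series_ext; intros j; f_equal.
    apply (mean_rot (L j) (fun x => ind (A (j, x)))).
Qed.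

Lemma first_letter_partition : finite_meas_partition (fun _ => True) 2 first_letter.
Proof.
  split; [auto|split].
  - intros i j x _ _ Hij Hi Hj; apply Hij; now rewrite Hi, Hj.
  - intros x; exists (Nat.b2n (hd false (snd x))); split; [|reflexivity].
    destruct (hd false (snd x)); simpl; lia.
Qed.

(** The [mix] measure of the join cell of [w], since [shift] never leaves a component. *)
Definition word_mass (L : nat -> nat) (v : nat -> R) (w : list nat) : R :=
  Series (fun j => v j * mean (L j) (fun x => ind (reads w x))).

Lemma H_join_shift (L : nat -> nat) (v : nat -> R) (g : R -> R) (n : nat) :
  H_join (mix L v) shift 2 first_letter g n = lsum (fun w => g (word_mass L v w)) (words 2 n).
Proof.
  apply lsum_ext; intros w _; f_equal; apply Series_ext; intros j; f_equal.
  apply mean_ext; intros x _; apply ind_iff; unfold join_cell, reads, first_letter.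
  assert (E : forall i, Nat.iter i shift (j, x) = (j, Nat.iter i rot x)).
  { induction i as [|i IH]; [reflexivity|]; simpl; now rewrite IH. }
  split; intros H i Hi; specialize (H i Hi); [rewrite E in H|rewrite E]; exact H.
Qed.

(** * Concave functions vanishing at the origin *)

Lemma concave_scale (g : R -> R) (t x : R) :
  in_G0 g -> 0 <= t <= 1 -> 0 <= x <= 1 -> t * g x <= g (t * x).
Proof.
  intros (Hc & H0 & _) Ht Hx; specialize (Hc x 0 t Hx ltac:(lra) Ht).
  rewrite H0, !Rmult_0_r, !Rplus_0_r in Hc; exact Hc.
Qed.

(** Both [x] and [y] are fractions of [x + y], and scaling down towards [g 0 = 0] loses at most
    proportionally. *)
Lemma concave_subadditive (g : R -> R) (x y : R) :
  in_G0 g -> 0 <= x -> 0 <= y -> x + y <= 1 -> g (x + y) <= g x + g y.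
Proof.
  intros Hg Hx Hy Hs.
  destruct (Req_dec (x + y) 0) as [E|E].
  { replace x with 0 by lra; replace y with 0 by lra; rewrite Rplus_0_r.
    destruct Hg as (_ & -> & _); lra. }
  assert (Hp : 0 < / (x + y)) by (apply Rinv_0_lt_compat; lra).
  assert (Ht : forall z, 0 <= z <= x + y -> 0 <= z / (x + y) <= 1).
  { intros z Hz; split; [apply Rmult_le_pos; lra|].
    apply (Rmult_le_reg_r (x + y)); [lra|]; unfold Rdiv; rewrite Rmult_assoc, Rinv_l; lra. }
  assert (A := concave_scale g _ (x + y) Hg (Ht x ltac:(lra)) ltac:(lra)).
  assert (B := concave_scale g _ (x + y) Hg (Ht y ltac:(lra)) ltac:(lra)).
  replace (x / (x + y) * (x + y)) with x in A by (field; lra).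
  replace (y / (x + y) * (x + y)) with y in B by (field; lra).
  replace (g (x + y)) with (x / (x + y) * g (x + y) + y / (x + y) * g (x + y)) by (field; lra).
  lra.
Qed.

(** The extra summand [r] serves the induction, where it absorbs [a (S J)]; later it holds the mass
    of the unfinished components. *)
Lemma concave_subadditive_sum (g : R -> R) (a : nat -> R) (J : nat) (r : R) :
  in_G0 g -> (forall j, 0 <= a j) -> 0 <= r -> sum_f_R0 a J + r <= 1 ->
  g (sum_f_R0 a J + r) <= sum_f_R0 (fun j => g (a j)) J + g r.
Proof.
  intros Hg Ha; revert r; induction J as [|J IH]; simpl; intros r Hr Hs.
  - apply concave_subadditive; auto.
  - assert (HaS := Ha (S J)); rewrite Rplus_assoc in Hs |- *.
    assert (0 <= sum_f_R0 a J) by (apply cond_pos_sum; auto).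
    specialize (IH (a (S J) + r) ltac:(lra) Hs).
    assert (H' := concave_subadditive g (a (S J)) r Hg HaS Hr ltac:(lra)); lra.
Qed.

(* [x + y] lies between [x] and [1]: a concave function drops no faster than its chord there. *)
Lemma concave_drop (g : R -> R) (x y K : R) :
  in_G0 g -> 0 <= x <= 1 / 2 -> 0 <= y -> x + y <= 1 -> g x <= K -> 0 <= K ->
  g x - 2 * (K + Rabs (g 1)) * y <= g (x + y).
Proof.
  intros (Hc & _) Hx Hy Hs HK HK0.
  set (s := y / (1 - x)).
  assert (Hi : 0 < / (1 - x)) by (apply Rinv_0_lt_compat; lra).
  assert (Hs0 : 0 <= s) by (apply Rmult_le_pos; lra).
  assert (Hsx : s * (1 - x) = y) by (unfold s; field; lra).
  assert (Hs1 : s <= 1) by (apply (Rmult_le_reg_r (1 - x)); lra).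
  assert (Hs2 : s <= 2 * y) by (rewrite <- Hsx; nra).
  specialize (Hc x 1 (1 - s) ltac:(lra) ltac:(lra) ltac:(lra)).
  replace ((1 - s) * x + (1 - (1 - s)) * 1) with (x + y) in Hc by (rewrite <- Hsx; ring).
  assert (H1 := Rle_abs (- g 1)); rewrite Rabs_Ropp in H1; assert (H2 := Rabs_pos (g 1)).
  assert (s * (g x - g 1) <= s * (K + Rabs (g 1))) by (apply Rmult_le_compat_l; lra).
  assert (s * (K + Rabs (g 1)) <= 2 * y * (K + Rabs (g 1))) by (apply Rmult_le_compat_r; lra).
  lra.
Qed.

(** Below [1] the logarithm is negative, so the quotient by [eta] can be multiplied out. *)
Lemma G0_infty_lower_bound (g : R -> R) (M : R) :
  in_G0_infty g -> exists d, 0 < d <= 1 /\ forall x, 0 < x < d -> M * (- x * ln x) <= g x.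
Proof.
  intros [_ H]; destruct (H M) as (d & Hd & HM).
  exists (Rmin d 1); split; [split; [apply Rmin_glb_lt; lra|apply Rmin_r]|].
  intros x Hx; assert (Rmin d 1 <= d) by apply Rmin_l; assert (Rmin d 1 <= 1) by apply Rmin_r.
  specialize (HM x ltac:(lra)); unfold eta in HM.
  destruct (Req_EM_T x 0) as [|_]; [lra|].
  assert (Hl : ln x < 0) by (rewrite <- ln_1; apply ln_increasing; lra).
  assert (He : 0 < - x * ln x) by nra.
  apply (Rmult_lt_compat_r _ _ _ He) in HM.
  unfold Rdiv in HM; rewrite Rmult_assoc, Rinv_l in HM; lra.
Qed.

(** Some [a] has [g a > 0], while [g x <= g a] for all [x] near [0]. For [y] between [x] and [a],
    concavity then gives [g y >= g x]. *)
Lemma G0_infty_increasing_near_0 (g : R -> R) :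
  in_G0_infty g ->
  exists d, 0 < d <= 1 /\ forall x y, 0 <= x -> x <= y -> y < d -> g x <= g y.
Proof.
  intros Hg; destruct (G0_infty_lower_bound g 1 Hg) as (b & Hb & Hpos).
  set (a := b / 2); assert (Ha : 0 < a < b) by (unfold a; lra).
  assert (Hga : 0 < g a).
  { apply (Rlt_le_trans _ (1 * (- a * ln a))); [|now apply Hpos].
    assert (ln a < 0) by (rewrite <- ln_1; apply ln_increasing; lra); nra. }
  destruct Hg as [(Hc & H0 & Hl) _]; destruct (Hl (g a) Hga) as (d & Hd & Hsmall).
  exists (Rmin d a); split; [split; [apply Rmin_glb_lt|assert (Rmin d a <= a) by apply Rmin_r]; lra|].
  intros x y Hx Hxy Hy.
  assert (Rmin d a <= d) by apply Rmin_l; assert (Rmin d a <= a) by apply Rmin_r.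
  assert (Hgx : g x <= g a).
  { destruct (Req_dec x 0) as [->|]; [rewrite H0; lra|].
    specialize (Hsmall x ltac:(lra)); apply Rabs_def2 in Hsmall; lra. }
  set (t := (a - y) / (a - x)).
  assert (Hi : 0 < / (a - x)) by (apply Rinv_0_lt_compat; lra).
  assert (Ht0 : 0 <= t) by (apply Rmult_le_pos; lra).
  assert (Htx : t * (a - x) = a - y) by (unfold t; field; lra).
  assert (Ht1 : t <= 1) by (apply (Rmult_le_reg_r (a - x)); lra).
  specialize (Hc x a t ltac:(lra) ltac:(lra) ltac:(lra)).
  replace (t * x + (1 - t) * a) with y in Hc by lra.
  nra.
Qed.

(** * Choice of the levels *)

(** The contribution to the entropy sum of mass [v] shared equally among the [2 ^ n] words of length
    [n]. *)
Definition Phi (g : R -> R) (v : R) (n : nat) : R := 2 ^ n * g (v / 2 ^ n).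

Lemma div_pow2_bounds (v : R) (n : nat) : 0 <= v -> 0 <= v / 2 ^ n <= v.
Proof.
  intros Hv; assert (H1 := pow_R1_Rle 2 n ltac:(lra)).
  assert (Hi : 0 < / 2 ^ n) by (apply Rinv_0_lt_compat; lra).
  assert (Hi1 : / 2 ^ n <= 1) by (rewrite <- Rinv_1; apply Rinv_le_contravar; lra).
  unfold Rdiv; split; [apply Rmult_le_pos; lra|].
  rewrite <- (Rmult_1_r v) at 2; apply Rmult_le_compat_l; lra.
Qed.

(** There are at most [2 ^ N] atoms, and [b] is so small that [g] is at most [/ 2 ^ N] on each. *)
Lemma Phi_small (g : R -> R) (N : nat) :
  in_G0 g ->
  exists b, 0 < b <= 1 / 2 /\ forall t n, 0 <= t <= b -> (n <= N)%nat -> Phi g t n <= 1.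
Proof.
  intros (_ & H0 & Hl); assert (HN := pow_lt 2 N ltac:(lra)).
  destruct (Hl (/ 2 ^ N) (Rinv_0_lt_compat _ HN)) as (d & Hd & Hs).
  assert (Rmin (d / 2) (1 / 2) <= d / 2) by apply Rmin_l.
  exists (Rmin (d / 2) (1 / 2)); split; [split; [apply Rmin_glb_lt; lra|apply Rmin_r]|].
  intros t n Ht Hn; unfold Phi.
  assert (Hb := div_pow2_bounds t n ltac:(lra)).
  assert (Hg : g (t / 2 ^ n) <= / 2 ^ N).
  { destruct (Req_dec (t / 2 ^ n) 0) as [->|]; [rewrite H0; apply Rlt_le, Rinv_0_lt_compat, HN|].
    specialize (Hs (t / 2 ^ n) ltac:(lra)); apply Rabs_def2 in Hs; lra. }
  assert (Hp := pow_lt 2 n ltac:(lra)); assert (Hm := Rle_pow 2 n N ltac:(lra) Hn).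
  apply (Rle_trans _ (2 ^ n * / 2 ^ N)); [apply Rmult_le_compat_l; lra|].
  rewrite <- (Rinv_r (2 ^ N)) by lra; apply Rmult_le_compat_r; [|exact Hm].
  apply Rlt_le, Rinv_0_lt_compat, HN.
Qed.

(** If [g >= K * eta] near [0], then [Phi g v L >= K * v * (L * ln 2 - ln v)] for large [L]. With
    [K = gamma / (v * ln 2)] the first term is [gamma * L], and the second is nonnegative because
    [v < 1]. *)
Lemma Phi_superlinear (g : R -> R) (v gamma : R) (M : nat) :
  in_G0_infty g -> 0 < v < 1 -> 0 <= gamma ->
  exists L, (M < L)%nat /\ gamma * INR L <= Phi g v L.
Proof.
  intros Hg Hv Hgam; assert (Hln2 : 0 < ln 2) by (rewrite <- ln_1; apply ln_increasing; lra).
  assert (Hc : 0 < v * ln 2) by nra.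
  destruct (G0_infty_lower_bound g (gamma / (v * ln 2)) Hg) as (d & Hd & Hlow).
  destruct (Pow_x_infinity 2 ltac:(rewrite Rabs_pos_eq; lra) (2 / d)) as [N HN].
  set (L := (S M + N)%nat); exists L; split; [unfold L; lia|].
  specialize (HN L ltac:(unfold L; lia)).
  assert (Hp := pow_lt 2 L ltac:(lra)); rewrite Rabs_pos_eq in HN by lra.
  assert (Hx : 0 < v / 2 ^ L < d).
  { split; [apply Rdiv_lt_0_compat; lra|].
    apply (Rmult_lt_reg_r (2 ^ L)); [exact Hp|].
    replace (v / 2 ^ L * 2 ^ L) with v by (field; lra).
    apply Rge_le, (Rmult_le_compat_l d) in HN; [|lra].
    replace (d * (2 / d)) with 2 in HN by (field; lra); lra. }
  specialize (Hlow _ Hx); unfold Phi.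
  apply (Rmult_le_compat_l (2 ^ L)) in Hlow; [|lra].
  apply (Rle_trans _ _ _) with (2 := Hlow).
  rewrite ln_div, ln_pow by lra.
  replace (2 ^ L * _) with (gamma * INR L + gamma / ln 2 * - ln v) by (field; repeat split; lra).
  assert (ln v < 0) by (rewrite <- ln_1; apply ln_increasing; lra).
  assert (0 <= gamma / ln 2) by (apply Rmult_le_pos; [lra|apply Rlt_le, Rinv_0_lt_compat, Hln2]).
  nra.
Qed.

(** Continuity is given on the open interval, so the interval used starts at some [a > 0] with
    [g a < c]; the extreme values of [c] are treated apart to have strict signs at both ends. *)
Lemma G0_intermediate_value (g : R -> R) (x c : R) :
  in_G0 g -> (forall z, 0 < z < 1 -> continuity_pt g z) -> 0 < x < 1 -> 0 <= c <= g x ->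
  exists z, 0 <= z <= x /\ g z = c.
Proof.
  intros (_ & H0 & Hl) Hcont Hx Hc.
  destruct (Req_dec c 0) as [->|Hc0]; [exists 0; split; [lra|exact H0]|].
  destruct (Req_dec c (g x)) as [->|Hcx]; [exists x; split; [lra|reflexivity]|].
  destruct (Hl c ltac:(lra)) as (d & Hd & Hs).
  set (a := Rmin (d / 2) (x / 2)).
  assert (Ha0 : 0 < a) by (apply Rmin_glb_lt; lra).
  assert (Had : a <= d / 2) by apply Rmin_l; assert (Hax : a <= x / 2) by apply Rmin_r.
  specialize (Hs a ltac:(lra)); apply Rabs_def2 in Hs.
  destruct (IVT_interv (fun z => g z - c) a x) as (z & Hz & Ez); [|lra|lra|lra|].
  - intros z Hz; apply continuity_pt_minus; [apply Hcont; lra|].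
    apply continuity_pt_const; intros ? ?; reflexivity.
  - exists z; split; lra.
Qed.

Lemma exists_level (g : R -> R) (gamma b : R) (M : nat) :
  in_G0_infty g -> (forall z, 0 < z < 1 -> continuity_pt g z) -> 0 <= gamma -> 0 < b ->
  exists (v : R) (L : nat),
    0 <= v <= b /\ (M < L)%nat /\
    (forall n, (n <= M)%nat -> Phi g v n <= 1) /\
    (forall n, (M < n <= L)%nat -> Phi g v n <= gamma * INR n) /\
    Phi g v L = gamma * INR L.
Proof.
  intros Hg Hcont Hgam Hb.
  destruct (G0_infty_increasing_near_0 g Hg) as (d & Hd & Hinc).
  destruct (Phi_small g M (proj1 Hg)) as (e & He & Hsmall).
  (* The trial mass: within the allowance [b], at most [e] for the bound up to [M], and inside the
     range where [g] increases. *)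
  set (u := Rmin b (Rmin e (d / 2))).
  assert (Hu : 0 < u) by (repeat apply Rmin_glb_lt; lra).
  assert (Hub : u <= b) by apply Rmin_l.
  assert (Hue : u <= e) by (apply (Rle_trans _ _ _ (Rmin_r _ _)), Rmin_l).
  assert (Hud : u <= d / 2) by (apply (Rle_trans _ _ _ (Rmin_r _ _)), Rmin_r).
  (* [L] is the first length beyond [M] at which mass [u] reaches the line [gamma * n]; between [M]
     and [L] it stays below. *)
  destruct (dec_inh_nat_subset_has_unique_least_element
              (fun L => (M < L)%nat /\ gamma * INR L <= Phi g u L)) as (L & ((HML & HL) & Hmin) & _).
  { intros n; apply classic. }
  { apply Phi_superlinear; auto; lra. }
  assert (Hp := pow_lt 2 L ltac:(lra)).
  assert (Hux := div_pow2_bounds u L ltac:(lra)).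
  (* The atom size is lowered until equality holds at [L]. The resulting mass [z * 2 ^ L] is at most
     [u], so monotonicity preserves the bounds at earlier lengths. *)
  destruct (G0_intermediate_value g (u / 2 ^ L) (gamma * INR L / 2 ^ L)) as (z & Hz & Ez).
  { apply Hg. } { exact Hcont. }
  { split; [apply Rdiv_lt_0_compat; lra|lra]. }
  { split; [apply Rmult_le_pos; [apply Rmult_le_pos; [lra|apply pos_INR]|
      apply Rlt_le, Rinv_0_lt_compat, Hp]|].
    apply (Rmult_le_reg_l (2 ^ L)); [exact Hp|].
    replace (2 ^ L * (gamma * INR L / 2 ^ L)) with (gamma * INR L) by (field; lra); exact HL. }
  set (v := z * 2 ^ L).
  assert (Hvz : v / 2 ^ L = z) by (unfold v; field; lra).
  assert (Hv : 0 <= v <= u).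
  { split; [apply Rmult_le_pos; lra|].
    replace u with (u / 2 ^ L * 2 ^ L) by (field; lra); apply Rmult_le_compat_r; lra. }
  assert (Htop : Phi g v L = gamma * INR L).
  { unfold Phi; rewrite Hvz, Ez; field; lra. }
  exists v, L; split; [lra|split; [exact HML|split; [|split; [|exact Htop]]]].
  - intros n Hn; apply Hsmall; [lra|exact Hn].
  - intros n [HMn HnL]; destruct (Nat.eq_dec n L) as [->|HnL']; [lra|].
    apply (Rle_trans _ (Phi g u n)).
    + assert (Hpn := pow_lt 2 n ltac:(lra)); unfold Phi; apply Rmult_le_compat_l; [lra|].
      apply Hinc.
      * apply div_pow2_bounds; lra.
      * apply Rmult_le_compat_r; [apply Rlt_le, Rinv_0_lt_compat, Hpn|lra].
      * assert (A := div_pow2_bounds u n ltac:(lra)); lra.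
    + destruct (Rle_lt_dec (Phi g u n) (gamma * INR n)) as [|H]; [assumption|].
      specialize (Hmin n ltac:(split; [exact HMn|lra])); lia.
Qed.

(** * Recursive construction of the lengths and masses *)

(** [A J] is the sum of [L 1], ..., [L J], so the finished components from [1] to [J] contribute at
    most [gamma * A J]. The square in [tower_gap] makes this of order [sqrt n] once component [S J]
    matters; [tower_tail] bounds all components after [S J] together. *)
Record tower (g : R -> R) (gamma : R) (L A : nat -> nat) (v : nat -> R) : Prop := {
  tower_nonneg : forall j, 0 <= v j;
  tower_sum : is_series v 1;
  tower_L0 : L O = O;
  tower_A0 : A O = O;
  tower_AS : forall J, A (S J) = (A J + L (S J))%nat;
  tower_gap : forall J, ((A J + 1) ^ 2 < L (S J))%nat;
  tower_half : forall J, v (S J) <= 1 / 2;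
  tower_early : forall J n, (n <= (A J + 1) ^ 2)%nat -> Phi g (v (S J)) n <= 1;
  tower_late : forall J n, ((A J + 1) ^ 2 < n <= L (S J))%nat -> Phi g (v (S J)) n <= gamma * INR n;
  tower_top : forall J, Phi g (v (S J)) (L (S J)) = gamma * INR (L (S J));
  tower_tail : forall J n, (n <= L (S J))%nat ->
    Phi g (Series (fun k => v (S (S J) + k)%nat)) n <= 1
}.

(** State of the recursion: [total] is the sum of the lengths so far, [budget] a bound for the total
    mass of all later components. *)
Record level := { len : nat; weight : R; budget : posreal; total : nat }.

Definition level_succ (g : R -> R) (gamma : R) (s s' : level) : Prop :=
  let M := ((total s + 1) ^ 2)%nat in
  0 <= weight s' <= budget s / 2 /\ (M < len s')%nat /\ total s' = (total s + len s')%nat /\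
  budget s' <= budget s / 2 /\
  (forall n, (n <= M)%nat -> Phi g (weight s') n <= 1) /\
  (forall n, (M < n <= len s')%nat -> Phi g (weight s') n <= gamma * INR n) /\
  Phi g (weight s') (len s') = gamma * INR (len s') /\
  (forall t n, 0 <= t <= budget s' -> (n <= len s')%nat -> Phi g t n <= 1).

Lemma exists_level_succ (g : R -> R) (gamma : R) (s : level) :
  in_G0_infty g -> (forall z, 0 < z < 1 -> continuity_pt g z) -> 0 <= gamma ->
  exists s', level_succ g gamma s s'.
Proof.
  intros Hg Hcont Hgam; assert (Hb := cond_pos (budget s)).
  destruct (exists_level g gamma (budget s / 2) ((total s + 1) ^ 2)) as (v & L & H); auto; [lra|].
  destruct (Phi_small g L (proj1 Hg)) as (e & He & Hsmall).
  (* Below [e], all later mass together counts at most [1] up to time [L]; the halving makes the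
     later masses sum to at most the old budget. *)
  assert (Hr : 0 < Rmin e (budget s / 2)) by (apply Rmin_glb_lt; lra).
  exists (Build_level L v (mkposreal _ Hr) (total s + L)); unfold level_succ; simpl.
  assert (Hre : Rmin e (budget s / 2) <= e) by apply Rmin_l.
  assert (Hrb : Rmin e (budget s / 2) <= budget s / 2) by apply Rmin_r.
  repeat split; try tauto; try apply H.
  intros t n Ht; apply Hsmall; lra.
Qed.

Lemma exists_tower (g : R -> R) (gamma : R) :
  in_G0_infty g -> (forall z, 0 < z < 1 -> continuity_pt g z) -> 0 <= gamma ->
  exists L A v, tower g gamma L A v.
Proof.
  intros Hg Hcont Hgam.
  assert (Hhalf : 0 < 1 / 2) by lra.
  set (next := fun s => proj1_sig (constructive_indefinite_description _
                 (exists_level_succ g gamma s Hg Hcont Hgam))).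
  assert (Hnext : forall s, level_succ g gamma s (next s)).
  { intros s; unfold next; apply proj2_sig. }
  (* The initial budget [1 / 2] bounds the total mass of components [1], [2], and so on. *)
  set (s := fun j => Nat.iter j next (Build_level 0 0 (mkposreal _ Hhalf) 0)).
  assert (Hs : forall j, level_succ g gamma (s j) (s (S j))) by (intros j; apply Hnext).
  clearbody next; clear Hnext.
  assert (Hbudget : forall J k, budget (s (J + k)%nat) <= budget (s J) * (1 / 2) ^ k).
  { intros J; induction k as [|k IH]; [rewrite Nat.add_0_r; simpl; lra|].
    rewrite Nat.add_succ_r; destruct (Hs (J + k)%nat) as (_ & _ & _ & Hb & _).
    rewrite <- tech_pow_Rmult; lra. }
  set (w := fun j => weight (s (S j))).
  assert (Hw : forall J k, 0 <= w (J + k)%nat <= budget (s J) / 2 * (1 / 2) ^ k).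
  { intros J k; destruct (Hs (J + k)%nat) as (Hb & _); specialize (Hbudget J k); unfold w; lra. }
  assert (Hgeom : forall J, is_series (fun k => budget (s J) / 2 * (1 / 2) ^ k) (budget (s J))).
  { intros J; assert (H : Rabs (1 / 2) < 1) by (rewrite Rabs_pos_eq; lra).
    assert (H' := is_series_scal (budget (s J) / 2) _ _ (is_series_geom _ H)).
    replace (scal _ _) with (pos (budget (s J))) in H' by (unfold scal; simpl; unfold mult; simpl; field).
    exact H'. }
  assert (Hex : forall J, ex_series (fun k => w (J + k)%nat)).
  { intros J.
    apply (@ex_series_le R_AbsRing R_CompleteNormedModule _ (fun k => budget (s J) / 2 * (1 / 2) ^ k)).
    - intros k; change (Rabs (w (J + k)%nat) <= budget (s J) / 2 * (1 / 2) ^ k).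
      rewrite Rabs_pos_eq; apply Hw.
    - eexists; apply Hgeom. }
  assert (Htail : forall J, 0 <= Series (fun k => w (J + k)%nat) <= budget (s J)).
  { intros J; split; [apply Series_nonneg; [intros k; apply Hw|apply Hex]|].
    rewrite <- (is_series_unique _ _ (Hgeom J)).
    apply Series_le; [apply Hw|eexists; apply Hgeom]. }
  (* Component [0] receives the mass that is left over, at least [1 / 2]. *)
  set (v := fun j => match j with O => 1 - Series w | S j => w j end).
  exists (fun j => len (s j)), (fun j => total (s j)), v.
  constructor; try reflexivity; try (intros J; apply (Hs J)).
  - intros [|j]; simpl; [|rewrite <- (Nat.add_0_r j); apply Hw].
    assert (H := Htail O); change (Series (fun k => w (0 + k)%nat)) with (Series w) in H.
    simpl in H; lra.
  - apply (is_series_decr_1 v); change (is_series w (1 + - (1 - Series w))).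
    replace (1 + - (1 - Series w)) with (Series w) by ring.
    apply Series_correct, (Hex O).
  - intros J; assert (H := Hw J O); rewrite Nat.add_0_r in H; simpl in H; unfold v.
    enough (budget (s J) <= 1 / 2) by lra; clear H.
    induction J as [|J IH]; [simpl; lra|].
    destruct (Hs J) as (_ & _ & _ & Hb & _); assert (Hp := cond_pos (budget (s J))); lra.
  - intros J n Hn; destruct (Hs J) as (_ & _ & _ & _ & _ & _ & _ & H).
    apply (H _ n (Htail (S J)) Hn).
Qed.

(** * Entropy of a tower *)

Lemma sum_f_R0_lsum {A : Type} (F : nat -> A -> R) (J : nat) (l : list A) :
  lsum (fun a => sum_f_R0 (fun j => F j a) J) l = sum_f_R0 (fun j => lsum (F j) l) J.
Proof.
  induction J as [|J IH]; simpl; [reflexivity|].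
  now rewrite <- IH, <- lsum_plus.
Qed.

(** A word mean here is [0] or [/ 2 ^ m], and on these two values [g (v * mean)] equals
    [Phi g v m * mean]. As the means sum to [1], no words need counting. *)
Lemma lsum_short_component (g : R -> R) (v : R) (m n : nat) :
  in_G0 g -> (m <= n)%nat ->
  lsum (fun w => g (v * mean m (fun x => ind (reads w x)))) (words 2 n) = Phi g v m.
Proof.
  intros (_ & H0 & _) Hmn.
  rewrite <- (Rmult_1_r (Phi g v m)), <- (lsum_mean_reads m n), <- lsum_scal.
  apply lsum_ext; intros w Hw; destruct (words_spec n w Hw) as [Hl _].
  assert (Hp := pow_lt 2 m ltac:(lra)); unfold Phi.
  destruct (mean_reads_short w m ltac:(lia)) as [->| ->].
  - now rewrite !Rmult_0_r.
  - unfold Rdiv; field; lra.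
Qed.

Lemma word_mass_le_1 (L : nat -> nat) (v : nat -> R) (w : list nat) :
  (forall j, 0 <= v j) -> is_series v 1 -> word_mass L v w <= 1.
Proof.
  intros Hv Hs; rewrite <- (is_series_unique v 1 Hs).
  apply Series_le; [|now exists 1]; intros j; specialize (Hv j).
  assert (H := mean_ind_bound (L j) (reads w)); split; [apply Rmult_le_pos; lra|].
  rewrite <- (Rmult_1_r (v j)) at 2; apply Rmult_le_compat_l; lra.
Qed.

Lemma tower_L_le_A (g : R -> R) (gamma : R) (L A : nat -> nat) (v : nat -> R) (J : nat) :
  tower g gamma L A v -> (L J <= A J)%nat.
Proof.
  intros Ht; destruct J as [|J]; [rewrite (tower_L0 _ _ _ _ _ Ht); lia|].
  rewrite (tower_AS _ _ _ _ _ Ht); lia.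
Qed.

Lemma tower_L_mono (g : R -> R) (gamma : R) (L A : nat -> nat) (v : nat -> R) (i j : nat) :
  tower g gamma L A v -> (i <= j)%nat -> (L i <= L j)%nat.
Proof.
  intros Ht Hij; induction Hij as [|j _ IH]; [lia|].
  assert (H1 := tower_gap _ _ _ _ _ Ht j); assert (H2 := tower_L_le_A _ _ _ _ _ j Ht).
  simpl in H1; nia.
Qed.

Lemma tower_index_le_L (g : R -> R) (gamma : R) (L A : nat -> nat) (v : nat -> R) (J : nat) :
  tower g gamma L A v -> (J <= L J)%nat.
Proof.
  intros Ht; induction J as [|J IH]; [lia|].
  assert (H1 := tower_gap _ _ _ _ _ Ht J); assert (H2 := tower_L_le_A _ _ _ _ _ J Ht).
  simpl in H1; nia.
Qed.

Lemma tower_index (g : R -> R) (gamma : R) (L A : nat -> nat) (v : nat -> R) (n : nat) :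
  tower g gamma L A v -> (0 < n)%nat -> exists J, (L J < n <= L (S J))%nat.
Proof.
  intros Ht Hn.
  assert (H : forall K, (n <= L K)%nat -> exists J, (L J < n <= L (S J))%nat).
  { induction K as [|K IH]; intros HK; [rewrite (tower_L0 _ _ _ _ _ Ht) in HK; lia|].
    destruct (le_lt_dec n (L K)); [auto|exists K; lia]. }
  apply (H n), (tower_index_le_L _ _ _ _ _ n Ht).
Qed.

(* Components beyond [J] have period at least [n], so they give all words of length [n] the same mass. *)
Lemma word_mass_split (g : R -> R) (gamma : R) (L A : nat -> nat) (v : nat -> R) (J n : nat)
  (w : list nat) :
  tower g gamma L A v -> (n <= L (S J))%nat -> In w (words 2 n) ->
  word_mass L v w =
  sum_f_R0 (fun j => v j * mean (L j) (fun x => ind (reads w x))) J +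
  (v (S J) / 2 ^ n + Series (fun k => v (S (S J) + k)%nat) / 2 ^ n).
Proof.
  intros Ht Hn Hw; destruct (words_spec n w Hw) as [Hl Hf].
  assert (Hv := tower_nonneg _ _ _ _ _ Ht).
  assert (Hs : ex_series v) by (exists 1; apply (tower_sum _ _ _ _ _ Ht)).
  unfold word_mass; rewrite (Series_split _ J).
  2:{ apply ex_series_weighted; auto; intros j; apply mean_ind_bound. }
  f_equal; rewrite (Series_ext _ (fun k => v (S J + k)%nat * / 2 ^ n)).
  2:{ intros k; rewrite mean_reads_long, Hl; auto.
      assert (H := tower_L_mono _ _ _ _ _ (S J) (S J + k) Ht ltac:(lia)); lia. }
  rewrite Series_scal_r, (Series_split (fun k => v (S J + k)%nat) 0).
  2:{ apply (ex_series_incr_n v), Hs. }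
  simpl; rewrite Nat.add_0_r; unfold Rdiv; rewrite Rmult_plus_distr_r; do 2 f_equal.
  apply Series_ext; intros k; f_equal; lia.
Qed.

Lemma lsum_word_mass (g : R -> R) (gamma : R) (L A : nat -> nat) (v : nat -> R) (J n : nat) :
  tower g gamma L A v -> (n <= L (S J))%nat -> lsum (word_mass L v) (words 2 n) = 1.
Proof.
  intros Ht Hn; assert (Hs := tower_sum _ _ _ _ _ Ht).
  rewrite (lsum_ext _ _ _ (fun w Hw => word_mass_split _ _ _ _ _ J n w Ht Hn Hw)).
  rewrite lsum_plus, lsum_words_const.
  rewrite (sum_f_R0_lsum (fun j w => v j * mean (L j) (fun x => ind (reads w x)))).
  rewrite (sum_eq _ v) by (intros j _; rewrite lsum_scal, lsum_mean_reads; ring).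
  rewrite <- (is_series_unique v 1 Hs), (Series_split v (S J)) by now exists 1.
  assert (Hp := pow_lt 2 n ltac:(lra)); rewrite tech5; field; lra.
Qed.

(** Subadditivity separates the components. Component [0] gives [g (v O)], the finished ones
    [gamma * L j] each, the current one [Phi], and the rest at most [1]. *)
Lemma entropy_sum_le (g : R -> R) (gamma : R) (L A : nat -> nat) (v : nat -> R) (J n : nat) :
  in_G0 g -> tower g gamma L A v -> (L J < n <= L (S J))%nat ->
  lsum (fun w => g (word_mass L v w)) (words 2 n) <=
  g (v O) + gamma * INR (A J) + Phi g (v (S J)) n + 1.
Proof.
  intros Hg Ht Hn; assert (Hv := tower_nonneg _ _ _ _ _ Ht).
  assert (Hs := tower_sum _ _ _ _ _ Ht); assert (Hp := pow_lt 2 n ltac:(lra)).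
  set (tl := Series (fun k => v (S (S J) + k)%nat)).
  assert (Htl : 0 <= tl).
  { apply Series_nonneg; [intros k; apply Hv|].
    apply (ex_series_incr_n v); now exists 1. }
  set (c := fun w j => v j * mean (L j) (fun x => ind (reads w x))).
  assert (Hcomp : sum_f_R0 (fun j => Phi g (v j) (L j)) J = g (v O) + gamma * INR (A J)).
  { clear -Ht; induction J as [|J IH]; simpl.
    - rewrite (tower_L0 _ _ _ _ _ Ht), (tower_A0 _ _ _ _ _ Ht); unfold Phi; simpl.
      rewrite Rdiv_1_r; ring.
    - rewrite IH, (tower_top _ _ _ _ _ Ht), (tower_AS _ _ _ _ _ Ht), plus_INR; ring. }
  apply (Rle_trans _ (lsum (fun w => sum_f_R0 (fun j => g (c w j)) J +
           (g (v (S J) / 2 ^ n) + g (tl / 2 ^ n))) (words 2 n))).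
  - apply lsum_le; intros w Hw.
    assert (H1 := word_mass_le_1 L v w Hv Hs).
    rewrite (word_mass_split _ _ _ _ _ J n w Ht ltac:(lia) Hw) in H1 |- *; fold tl in H1 |- *.
    change (fun j => v j * mean (L j) (fun x => ind (reads w x))) with (c w) in H1 |- *.
    assert (Hc : forall j, 0 <= c w j).
    { intros j; apply Rmult_le_pos; [apply Hv|apply mean_ind_bound]. }
    assert (Ha := div_pow2_bounds (v (S J)) n (Hv _)); assert (Hb := div_pow2_bounds tl n Htl).
    assert (H2 := concave_subadditive_sum g (c w) J _ Hg Hc
                    ltac:(apply Rplus_le_le_0_compat; [apply Ha|apply Hb]) H1).
    assert (0 <= sum_f_R0 (c w) J) by (apply cond_pos_sum; auto).
    assert (H3 := concave_subadditive g _ _ Hg (proj1 Ha) (proj1 Hb) ltac:(lra)); lra.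
  - rewrite lsum_plus, lsum_words_const, (sum_f_R0_lsum (fun j w => g (c w j))).
    rewrite (sum_eq _ (fun j => Phi g (v j) (L j))), Hcomp.
    + assert (H := tower_tail _ _ _ _ _ Ht J n ltac:(lia)); fold tl in H.
      unfold Phi in *; lra.
    + intros j Hj; apply lsum_short_component; [exact Hg|].
      assert (H := tower_L_mono _ _ _ _ _ j J Ht Hj); lia.
Qed.

Lemma entropy_sum_le_sqrt (g : R -> R) (gamma : R) (L A : nat -> nat) (v : nat -> R) (n : nat) :
  in_G0 g -> 0 <= gamma -> tower g gamma L A v -> (0 < n)%nat ->
  lsum (fun w => g (word_mass L v w)) (words 2 n) <=
  gamma * INR n + (gamma + Rabs (g (v O)) + 2) * sqrt (INR n).
Proof.
  intros Hg Hgam Ht Hn; destruct (tower_index _ _ _ _ _ n Ht Hn) as [J HJ].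
  apply (Rle_trans _ _ _ (entropy_sum_le _ _ _ _ _ J n Hg Ht HJ)).
  assert (Hsq : forall a, ((a + 1) ^ 2 <= n)%nat -> INR a <= sqrt (INR n)).
  { intros a Ha; rewrite <- (sqrt_pow2 (INR a)) by apply pos_INR.
    apply sqrt_le_1_alt; rewrite <- pow_INR; apply le_INR; simpl in *; nia. }
  assert (Hn1 : 1 <= sqrt (INR n)).
  { rewrite <- sqrt_1; apply sqrt_le_1_alt, (le_INR 1); lia. }
  assert (Hg0 := Rle_abs (g (v O))); assert (Hg1 := Rabs_pos (g (v O))).
  assert (Hn0 := pos_INR n).
  (* The other terms, [g (v O)] and two units, are absorbed using [sqrt n >= 1]. *)
  enough (gamma * INR (A J) + Phi g (v (S J)) n <= gamma * INR n + gamma * sqrt (INR n) + 1) by nra.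
  (* Early in the window the current component gives at most [1], and [A J] is [L J < n] plus an
     earlier total below [sqrt n]. Later, [A J <= sqrt n] and the current component gives at most
     [gamma * n]. *)
  destruct (le_lt_dec n ((A J + 1) ^ 2)) as [Hle|Hlt].
  - assert (H := tower_early _ _ _ _ _ Ht J n Hle).
    enough (INR (A J) <= INR n + sqrt (INR n)) by nra.
    destruct J as [|J]; [rewrite (tower_A0 _ _ _ _ _ Ht); simpl; lra|].
    rewrite (tower_AS _ _ _ _ _ Ht), plus_INR.
    assert (H1 := tower_gap _ _ _ _ _ Ht J); assert (H2 := Hsq (A J) ltac:(lia)).
    assert (H3 : INR (L (S J)) <= INR n) by (apply le_INR; lia); lra.
  - assert (H := tower_late _ _ _ _ _ Ht J n ltac:(lia)).
    assert (H1 := Hsq (A J) ltac:(lia)); nra.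
Qed.

(** Component [S J] alone gives each word mass [x], with [2 ^ n * g x = gamma * n]. The other
    components add mass at most [1] in all, and by [concave_drop] lower the sum by at most a
    constant independent of [J]. *)
Lemma entropy_sum_ge (g : R -> R) (gamma : R) (L A : nat -> nat) (v : nat -> R) (J : nat) :
  in_G0 g -> 0 <= gamma -> tower g gamma L A v ->
  gamma * INR (L (S J)) - 2 * (gamma + Rabs (g 1)) <=
  lsum (fun w => g (word_mass L v w)) (words 2 (L (S J))).
Proof.
  intros Hg Hgam Ht; set (n := L (S J)).
  assert (Hv := tower_nonneg _ _ _ _ _ Ht).
  assert (Hs := tower_sum _ _ _ _ _ Ht); assert (Hp := pow_lt 2 n ltac:(lra)).
  set (x := v (S J) / 2 ^ n).
  assert (Hx := div_pow2_bounds (v (S J)) n (Hv _)); fold x in Hx.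
  assert (Hx2 := tower_half _ _ _ _ _ Ht J).
  assert (Htop : 2 ^ n * g x = gamma * INR n) by apply (tower_top _ _ _ _ _ Ht J).
  (* From [n <= 2 ^ n], by Bernoulli's inequality. *)
  assert (Hgx : g x <= gamma).
  { apply (Rmult_le_reg_l (2 ^ n)); [exact Hp|]; rewrite Htop, Rmult_comm.
    apply Rmult_le_compat_r; [exact Hgam|].
    assert (H := poly n 1 ltac:(lra)); replace (1 + 1) with 2 in H by ring; lra. }
  set (K := 2 * (gamma + Rabs (g 1))).
  assert (HK : 0 <= K) by (assert (H := Rabs_pos (g 1)); unfold K; lra).
  apply (Rle_trans _ (lsum (fun w => (g x + K * x) + - K * word_mass L v w) (words 2 n))).
  - rewrite lsum_plus, lsum_words_const, lsum_scal.
    rewrite (lsum_word_mass _ _ _ _ _ J n Ht ltac:(unfold n; lia)).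
    assert (0 <= 2 ^ n * (K * x)) by (apply Rmult_le_pos; [|apply Rmult_le_pos]; lra).
    unfold K in *; lra.
  - apply lsum_le; intros w Hw.
    assert (H1 := word_mass_le_1 L v w Hv Hs).
    assert (Hy : x <= word_mass L v w).
    { rewrite (word_mass_split _ _ _ _ _ J n w Ht ltac:(unfold n; lia) Hw); fold x.
      assert (0 <= Series (fun k => v (S (S J) + k)%nat) / 2 ^ n).
      { apply div_pow2_bounds, Series_nonneg; [intros k; apply Hv|].
        apply (ex_series_incr_n v); now exists 1. }
      assert (0 <= sum_f_R0 (fun j => v j * mean (L j) (fun x => ind (reads w x))) J); [|lra].
      apply cond_pos_sum; intros j; apply Rmult_le_pos; [apply Hv|apply mean_ind_bound]. }
    assert (H := concave_drop g x (word_mass L v w - x) gamma Hg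
                   ltac:(lra) ltac:(lra) ltac:(lra) Hgx Hgam).
    replace (x + (word_mass L v w - x)) with (word_mass L v w) in H by ring.
    fold K in H; lra.
Qed.

Lemma tower_entropy (g : R -> R) (gamma : R) (L A : nat -> nat) (v : nat -> R) :
  in_G0 g -> 0 <= gamma -> tower g gamma L A v ->
  h_entropy_is (mix L v) shift 2 first_letter g gamma.
Proof.
  intros Hg Hgam Ht eps Heps; split.
  - set (D := gamma + Rabs (g (v O)) + 2).
    assert (HD : 0 < D) by (assert (H := Rabs_pos (g (v O))); unfold D; lra).
    (* Beyond this threshold the error [D * sqrt n] is below [eps * n]. *)
    destruct (INR_unbounded ((D / eps) ^ 2)) as [N HN].
    exists (S N); intros n Hn; rewrite H_join_shift.
    assert (Hnp : 0 < INR n) by (apply lt_0_INR; lia).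
    assert (Hq : D / eps < sqrt (INR n)).
    { assert (0 <= D / eps) by (apply Rlt_le, Rdiv_lt_0_compat; lra).
      rewrite <- (sqrt_pow2 (D / eps)) by assumption; apply sqrt_lt_1_alt; split.
      - apply pow2_ge_0.
      - apply (Rlt_le_trans _ _ _ HN), le_INR; lia. }
    assert (HDs : D < eps * sqrt (INR n)).
    { apply (Rmult_lt_compat_l eps) in Hq; [|exact Heps].
      replace (eps * (D / eps)) with D in Hq by (field; lra); exact Hq. }
    assert (Hss := sqrt_sqrt (INR n) ltac:(lra)); assert (Hsp := sqrt_lt_R0 _ Hnp).
    assert (H := entropy_sum_le_sqrt g gamma L A v n Hg Hgam Ht ltac:(lia)); fold D in H.
    apply (Rmult_lt_reg_r (INR n)); [exact Hnp|].
    unfold Rdiv; rewrite Rmult_assoc, Rinv_l, Rmult_1_r by lra.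
    apply (Rle_lt_trans _ _ _ H); rewrite Rmult_plus_distr_r.
    apply Rplus_lt_compat_l; rewrite <- Hss at 2; rewrite <- Rmult_assoc.
    now apply Rmult_lt_compat_r.
  - intros N; set (K := 2 * (gamma + Rabs (g 1))).
    destruct (INR_unbounded (K / eps)) as [M HM].
    (* Since [S J <= L (S J)], this time exceeds both [N] and [K / eps]. *)
    set (J := (N + M)%nat); exists (L (S J)); rewrite H_join_shift.
    assert (HJ := tower_index_le_L _ _ _ _ _ (S J) Ht).
    split; [unfold J in *; lia|].
    assert (Hnp : 0 < INR (L (S J))) by (apply lt_0_INR; lia).
    assert (Hn : K / eps < INR (L (S J))).
    { apply (Rlt_le_trans _ _ _ HM), le_INR; unfold J in *; lia. }
    apply (Rmult_lt_compat_l eps) in Hn; [|exact Heps].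
    replace (eps * (K / eps)) with K in Hn by (field; lra).
    assert (H := entropy_sum_ge g gamma L A v J Hg Hgam Ht); fold K in H.
    apply (Rmult_lt_reg_r (INR (L (S J)))); [exact Hnp|].
    unfold Rdiv; rewrite Rmult_assoc, Rinv_l, Rmult_1_r by lra; lra.
Qed.

Theorem mainTheorem11 (g : R -> R) :
  in_G0_infty g ->
  (* g differentiable on (0,1), with derivative g' *)
  forall g' : R -> R,
  (forall x, 0 < x < 1 -> derivable_pt_lim g x (g' x)) ->
  (* limsup_{x -> 0+} x g'(x) / g(x) < 1 *)
  (exists c delta, c < 1 /\ 0 < delta /\
     forall x, 0 < x < delta -> x * g' x / g x <= c) ->
  forall gamma : R, 0 <= gamma ->
  exists (X : Type) (S : (X -> Prop) -> Prop) (mu : (X -> Prop) -> R)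
         (T : X -> X) (k : nat) (P : nat -> X -> Prop),
    prob_space S mu /\ mp_automorphism S mu T /\
    finite_meas_partition S k P /\
    h_entropy_is mu T k P g gamma.
Proof.
  intros Hg g' Hder _ gamma Hgam.
  (* Differentiability supplies the continuity with which the masses are tuned by intermediate
     values. *)
  assert (Hcont : forall z, 0 < z < 1 -> continuity_pt g z).
  { intros z Hz; apply derivable_continuous_pt; exists (g' z); now apply Hder. }
  destruct (exists_tower g gamma Hg Hcont Hgam) as (L & A & v & Ht).
  exists (nat * list bool)%type, (fun _ => True), (mix L v), shift, 2%nat, first_letter.
  split; [|split; [|split]].
  - apply mix_prob_space; apply Ht.
  - apply shift_automorphism.
  - apply first_letter_partition.
  - apply (tower_entropy _ _ _ _ _ (proj1 Hg) Hgam Ht).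
Qed.
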